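(* Let $q\in\mathbb{C}$ with $0<|q|<1$ and let $(\alpha_n)_{n\ge 0}$, $\alpha_n=\alpha(q,n)$, be the associated parameter sequence. If the limit $$\lim_{n\to\infty}\left|\frac{\alpha_{n+1}}{[n+1]_q\,\alpha_n}\right|$$ exists and is equal to $l$, then the $q$-exponential function $$\mathcal{E}_{q,\alpha}(z)=\sum_{n=0}^{\infty}\frac{z^n}{[n]_q!}\,\alpha_n$$ is analytic in the disc $|z|<l^{-1}$.
   Context: For $q\neq 1$, $[n]_q=\frac{1-q^n}{1-q}$, and $[n]_q!=[1]_q[2]_q\cdots[n]_q$ with $[0]_q!=1$. The parameter $\alpha(q,n)$ is a complex-valued function of $q$ and of the integer $n\ge 0$, with $\alpha(q,n)\to 1$ as $q\to 1^-$. The existence of the limit presupposes that $\alpha_n\neq 0$ for all sufficiently large $n$, so that the quotients are defined. When $l=0$, $l^{-1}$ is read as $+\infty$ (the disc is all of $\mathbb{C}$). *)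

(* Defs.v *)
(* Stdlib reals with Coquelicot. *)
From Stdlib Require Import Reals.
From Coquelicot Require Export Coquelicot.
Open Scope C_scope.

Definition qnum (q : C) (n : nat) : C := (1 - q ^ n) / (1 - q).

Fixpoint qfact (q : C) (n : nat) : C :=
  match n with
  | O => 1
  | S m => qfact q m * qnum q (S m)
  end.

(* Coquelicot's [Series] is restricted to real series.  The value is meaningful
   only when [u] is summable. *)
Definition CSeries (u : nat -> C) : C :=
  iota (T := C_CompleteNormedModule)
       (fun s : C => is_series (V := C_NormedModule) u s).

Definition qexp_term (alpha : C -> nat -> C) (q z : C) (n : nat) : C :=
  z ^ n / qfact q n * alpha q n.

Definition qexp (alpha : C -> nat -> C) (q z : C) : C :=
  CSeries (qexp_term alpha q z).

(* Local representation by a power series, [is_pseries b h s] being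
   "b_0 + b_1 h + b_2 h^2 + ... converges to s". *)
Definition analytic_at (f : C -> C) (z0 : C) : Prop :=
  exists (r : R) (b : nat -> C), (0 < r)%R /\
    forall z : C, (Cmod (z - z0) < r)%R ->
      is_pseries (K := C_AbsRing) (V := C_NormedModule) b (z - z0) (f z).

Definition analytic_on (D : C -> Prop) (f : C -> C) : Prop :=
  forall z0 : C, D z0 -> analytic_at f z0.

(* [/ 0] has no useful value in [R], so the convention l^-1 = +oo for l = 0
   is made explicit. *)
Definition inv_radius (l : R) : Rbar :=
  if Req_EM_T l 0 then p_infty else Finite (/ l).

Definition open_disc (r : Rbar) (z : C) : Prop := Rbar_lt (Finite (Cmod z)) r.

(* Main.v *)
Require Import Defs.
From Stdlib Require Import Reals.
From Coquelicot Require Import Coquelicot.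
From Stdlib Require Import Lra Lia.
Open Scope C_scope.

(** Write [a n] for [alpha q n / qfact q n].  The ratio hypothesis says that
    [Cmod (a (S n)) / Cmod (a n)] tends to [l], so for every [R] with
    [R * l < 1] the sequence [Cmod (a n) * R ^ n] is eventually nonincreasing,
    hence bounded: this is [ratio_coef_bound].  Comparison with a geometric
    series then gives convergence in the disc.

    Analyticity at a point [w] other than the origin asks for a re-expansion
    of the series around [w].  The coefficients are
    [b k = sum_n a n * c(n, k)], where [c(n, k)] is the coefficient of [h ^ k]
    in [(w + h) ^ n].  Instead of exchanging two infinite sums, one subtracts
    finitely many terms: for each [K], linearity gives
    [f (w + h) - sum_(k < K) b k * h ^ k = sum_n a n * rem(n, K)], where
    [rem(n, K)] is the tail of order [K] of the expansion of [(w + h) ^ n].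
    If [Cmod h <= rho * s], the estimate
    [Cmod (rem(n, K)) <= rho ^ K * (Cmod w + s) ^ n] of
    [Cmod_shift_rem] makes the right-hand side at most a constant times
    [rho ^ K], provided [Cmod w + s] is inside the disc of convergence; this
    tends to 0 as soon as [Cmod h < s]. *)

(** * Series of complex numbers *)

Lemma pow_n_Cpow (z : C) (n : nat) : pow_n (K := C_Ring) z n = z ^ n.
Proof.
  induction n as [|n IH]; [reflexivity|].
  simpl. rewrite IH. reflexivity.
Qed.

Lemma CSeries_is_series (u : nat -> C) (s : C) :
  is_series (K := C_AbsRing) (V := C_NormedModule) u s -> CSeries u = s.
Proof.
  intros Hs.
  apply (iota_unique (V := C_CompleteNormedModule)); [|exact Hs].
  intros y Hy.
  exact (filterlim_locally_unique (V := C_NormedModule)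
           (F := eventually) (sum_n u) y s Hy Hs).
Qed.

Lemma is_series_CSeries (u : nat -> C) :
  ex_series (K := C_AbsRing) (V := C_NormedModule) u ->
  is_series (K := C_AbsRing) (V := C_NormedModule) u (CSeries u).
Proof.
  intros [s Hs]. rewrite (CSeries_is_series u s Hs). exact Hs.
Qed.

Lemma Cmod_is_series_le (u : nat -> C) (v : nat -> R) (s : C) (d : R) :
  (forall n, (Cmod (u n) <= v n)%R) ->
  is_series (K := C_AbsRing) (V := C_NormedModule) u s ->
  is_series v d ->
  (Cmod s <= d)%R.
Proof.
  intros Huv Hu Hv.
  apply (is_lim_seq_le
           (fun n => Cmod (sum_n (G := C_NormedModule) u n)) (sum_n v)
           (Finite (Cmod s)) (Finite d)).
  - intros n.
    apply Rle_trans with (sum_n (fun k => Cmod (u k)) n).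
    + apply (norm_sum_n_m (K := C_AbsRing) (V := C_NormedModule) u 0 n).
    + apply sum_n_m_le. exact Huv.
  - exact (filterlim_comp _ _ _ _ _ _ _ _ Hu
             (filterlim_norm (K := C_AbsRing) (V := C_NormedModule) s)).
  - exact Hv.
Qed.

Lemma is_series_geom_bound (M R S : R) :
  (0 <= S < R)%R ->
  is_series (fun n => M * (S / R) ^ n)%R (M * / (1 - S / R))%R.
Proof.
  intros HSR.
  apply (is_series_scal_l (K := R_AbsRing) (V := R_NormedModule) M).
  apply is_series_geom.
  rewrite Rabs_pos_eq.
  - apply Rmult_lt_reg_r with R; [lra|].
    unfold Rdiv. rewrite Rmult_assoc, Rinv_l; lra.
  - apply Rdiv_le_0_compat; lra.
Qed.

Lemma Cmod_mult_geom_le (a u : C) (M R S c : R) (n : nat) :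
  (0 < R)%R -> (0 <= c)%R -> (0 <= S)%R ->
  (Cmod a * R ^ n <= M)%R -> (Cmod u <= c * S ^ n)%R ->
  (Cmod (a * u) <= c * (M * (S / R) ^ n))%R.
Proof.
  intros HR Hc HS Ha Hu.
  assert (HRn : (0 < R ^ n)%R) by (apply pow_lt; exact HR).
  assert (HSn : (0 <= S ^ n)%R) by (apply pow_le; exact HS).
  rewrite Cmod_mult. unfold Rdiv. rewrite Rpow_mult_distr, pow_inv.
  apply Rmult_le_reg_r with (R ^ n)%R; [exact HRn|].
  replace (c * (M * (S ^ n * / R ^ n)) * R ^ n)%R with (M * (c * S ^ n))%R
    by (field; lra).
  replace (Cmod a * Cmod u * R ^ n)%R with ((Cmod a * R ^ n) * Cmod u)%R
    by ring.
  apply Rmult_le_compat; try apply Cmod_ge_0; auto.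
  apply Rmult_le_pos; [apply Cmod_ge_0 | lra].
Qed.

(** Comparison with a geometric series of ratio [S / R].  The factors [u n] are
    kept general because they are the powers of [z] for convergence at [z], and
    the expansion coefficients [shift_coef w n k] for the Taylor coefficients
    at [w]. *)
Lemma ex_series_geom_bound (a u : nat -> C) (M R S c : R) :
  (0 <= S < R)%R -> (0 <= c)%R ->
  (forall n, (Cmod (a n) * R ^ n <= M)%R) ->
  (forall n, (Cmod (u n) <= c * S ^ n)%R) ->
  ex_series (K := C_AbsRing) (V := C_NormedModule) (fun n => a n * u n).
Proof.
  intros HSR Hc Ha Hu.
  apply (ex_series_le (K := C_AbsRing) (V := C_CompleteNormedModule)
           (fun n => a n * u n) (fun n => c * (M * (S / R) ^ n))%R).
  - intros n. apply (Cmod_mult_geom_le (a n)); auto; lra.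
  - apply (ex_series_scal_l (K := R_AbsRing) (V := R_NormedModule) c
             (fun n => M * (S / R) ^ n)%R).
    exists (M * / (1 - S / R))%R. apply is_series_geom_bound; exact HSR.
Qed.

(** * Expansion of the powers of a sum *)

(** The coefficient of [h ^ k] in [(w + h) ^ n], that is,
    [binomial n k * w ^ (n - k)], and 0 when [n < k].  Pascal's rule is the
    only property needed, so it is taken as the definition. *)
Fixpoint shift_coef (w : C) (n k : nat) : C :=
  match n with
  | O => match k with O => 1 | S _ => 0 end
  | S n' =>
      w * shift_coef w n' k
      + match k with O => 0 | S k' => shift_coef w n' k' end
  end.

(** [(w + h) ^ n] minus the terms of degree less than [K] in [h]. *)
Fixpoint shift_rem (w h : C) (n K : nat) : C :=
  match K with
  | O => (w + h) ^ n
  | S K' => shift_rem w h n K' - h ^ K' * shift_coef w n K'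
  end.

Lemma Cmod_shift_coef (w : C) (s : R) (n k : nat) :
  (0 < s)%R ->
  (Cmod (shift_coef w n k) <= / s ^ k * (Cmod w + s) ^ n)%R.
Proof.
  intros Hs. revert k.
  assert (HS : (0 <= Cmod w + s)%R) by (pose proof (Cmod_ge_0 w); lra).
  induction n as [|n IH]; intros k.
  - destruct k as [|k]; simpl shift_coef.
    + rewrite Cmod_1. simpl. lra.
    + rewrite Cmod_0. apply Rmult_le_pos; [|simpl; lra].
      left. apply Rinv_0_lt_compat, pow_lt, Hs.
  - simpl shift_coef.
    eapply Rle_trans; [apply Cmod_triangle|]. rewrite Cmod_mult.
    pose proof (Rmult_le_compat_l _ _ _ (Cmod_ge_0 w) (IH k)) as H1.
    assert (H2 : (Cmod (match k with O => 0 | S k' => shift_coef w n k' end)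
                  <= s * (/ s ^ k * (Cmod w + s) ^ n))%R).
    { destruct k as [|k].
      - rewrite Cmod_0. apply Rmult_le_pos; [lra|].
        eapply Rle_trans; [apply Cmod_ge_0 | apply IH].
      - eapply Rle_trans; [apply IH|]. right.
        simpl. field. split; [apply pow_nonzero|]; lra. }
    simpl pow. lra.
Qed.

Lemma shift_rem_step (w h : C) (n K : nat) :
  shift_rem w h (S n) (S K)
  = w * shift_rem w h n (S K) + h * shift_rem w h n K.
Proof.
  induction K as [|K IH].
  - simpl. ring.
  - change (shift_rem w h (S n) (S (S K)))
      with (shift_rem w h (S n) (S K) - h ^ S K * shift_coef w (S n) (S K)).
    rewrite IH. simpl. ring.
Qed.

(** The recursion [shift_rem_step] has the same shape as
    [(Cmod w + s) ^ S n = Cmod w * (Cmod w + s) ^ n + s * (Cmod w + s) ^ n],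
    the factor [h] contributing [s] and one power of [rho]. *)
Lemma Cmod_shift_rem (w h : C) (s rho : R) (n K : nat) :
  (0 <= s)%R -> (0 <= rho <= 1)%R -> (Cmod h <= rho * s)%R ->
  (Cmod (shift_rem w h n K) <= rho ^ K * (Cmod w + s) ^ n)%R.
Proof.
  intros Hs Hrho Hh. revert K.
  assert (HS : (0 <= Cmod w + s)%R) by (pose proof (Cmod_ge_0 w); lra).
  assert (Hpow : forall m, (Cmod (shift_rem w h m 0)
                            <= rho ^ 0 * (Cmod w + s) ^ m)%R).
  { intros m. simpl. rewrite Cmod_pow, Rmult_1_l.
    apply pow_incr. split; [apply Cmod_ge_0|].
    eapply Rle_trans; [apply Cmod_triangle|]. nra. }
  induction n as [|n IH]; intros [|K]; try apply Hpow.
  - assert (Hone : shift_rem w h 0 (S K) = 0).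
    { induction K as [|K IHK]; [simpl; ring|].
      change (shift_rem w h 0 (S K) - h ^ S K * 0 = 0). rewrite IHK. ring. }
    rewrite Hone, Cmod_0. simpl pow at 2. rewrite Rmult_1_r.
    apply pow_le; lra.
  - rewrite shift_rem_step.
    eapply Rle_trans; [apply Cmod_triangle|]. rewrite !Cmod_mult.
    pose proof (Rmult_le_compat_l _ _ _ (Cmod_ge_0 w) (IH (S K))) as H1.
    pose proof (Rmult_le_compat _ _ _ _ (Cmod_ge_0 h)
                  (Cmod_ge_0 (shift_rem w h n K)) Hh (IH K)) as H2.
    replace (rho ^ S K * (Cmod w + s) ^ S n)%R
      with (Cmod w * (rho ^ S K * (Cmod w + s) ^ n)
            + rho * s * (rho ^ K * (Cmod w + s) ^ n))%R by (simpl; ring).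
    lra.
Qed.

(** * Re-expansion of a power series *)

(** Linearity for finitely many [k] only: no exchange of infinite sums. *)
Lemma is_series_shift_rem (a b : nat -> C) (w h f : C) :
  is_series (K := C_AbsRing) (V := C_NormedModule)
    (fun n => a n * (w + h) ^ n) f ->
  (forall k, is_series (K := C_AbsRing) (V := C_NormedModule)
               (fun n => a n * shift_coef w n k) (b k)) ->
  forall K,
    is_series (K := C_AbsRing) (V := C_NormedModule)
      (fun n => a n * shift_rem w h n (S K))
      (f - sum_n (G := C_NormedModule) (fun k => h ^ k * b k) K).
Proof.
  intros Hf Hb.
  assert (Hsub : forall (k : nat) (u : nat -> C) (s : C),
    is_series (K := C_AbsRing) (V := C_NormedModule)
      (fun n => a n * u n) s ->
    is_series (K := C_AbsRing) (V := C_NormedModule)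
      (fun n => a n * (u n - h ^ k * shift_coef w n k)) (s - h ^ k * b k)).
  { intros k u s Hu.
    eapply is_series_ext;
      [| exact (is_series_minus _ _ _ _ Hu
                  (is_series_scal_l (h ^ k) _ _ (Hb k)))].
    intros n. unfold plus, opp, scal; simpl. unfold mult; simpl. ring. }
  induction K as [|K IH].
  - rewrite sum_O. exact (Hsub 0%nat _ _ Hf).
  - rewrite sum_Sn.
    replace (f - plus _ _)
      with (f - sum_n (G := C_NormedModule) (fun k => h ^ k * b k) K
            - h ^ S K * b (S K))
      by (unfold plus; simpl; ring).
    exact (Hsub (S K) _ _ IH).
Qed.

Lemma is_pseries_shift (a b : nat -> C) (w h f : C) (M R s : R) :
  (forall n, (Cmod (a n) * R ^ n <= M)%R) ->
  (Cmod w + s < R)%R -> (Cmod h < s)%R ->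
  is_series (K := C_AbsRing) (V := C_NormedModule)
    (fun n => a n * (w + h) ^ n) f ->
  (forall k, is_series (K := C_AbsRing) (V := C_NormedModule)
               (fun n => a n * shift_coef w n k) (b k)) ->
  is_pseries (K := C_AbsRing) (V := C_NormedModule) b h f.
Proof.
  intros Ha HR Hh Hf Hb.
  pose proof (Cmod_ge_0 w) as Hw0. pose proof (Cmod_ge_0 h) as Hh0.
  set (rho := (Cmod h / s)%R).
  assert (Hrho : (0 <= rho < 1)%R).
  { unfold rho. split.
    - apply Rdiv_le_0_compat; lra.
    - apply Rmult_lt_reg_r with s; [lra|].
      unfold Rdiv. rewrite Rmult_assoc, Rinv_l; lra. }
  assert (Hhs : (Cmod h <= rho * s)%R) by (right; unfold rho; field; lra).
  set (P := sum_n (G := C_NormedModule) (fun k => h ^ k * b k)).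
  set (D := (M * / (1 - (Cmod w + s) / R))%R).
  assert (Hbound : forall K, (Cmod (f - P K) <= rho ^ S K * D)%R).
  { intros K.
    apply (Cmod_is_series_le (fun n => a n * shift_rem w h n (S K))
             (fun n => rho ^ S K * (M * ((Cmod w + s) / R) ^ n))%R).
    - intros n. apply Cmod_mult_geom_le; auto; try lra.
      + apply pow_le; lra.
      + apply Cmod_shift_rem; lra.
    - apply is_series_shift_rem; assumption.
    - apply (is_series_scal_l (K := R_AbsRing) (V := R_NormedModule)).
      apply is_series_geom_bound. lra. }
  assert (Hlim : is_lim_seq (fun K => rho ^ S K * D)%R (Finite 0)).
  { apply (is_lim_seq_incr_1 (fun K => rho ^ K * D)%R).
    replace (Finite 0) with (Rbar_mult (Finite 0) (Finite D))
      by (simpl; f_equal; ring).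
    apply is_lim_seq_scal_r, is_lim_seq_geom.
    rewrite Rabs_pos_eq; lra. }
  unfold is_pseries, is_series.
  apply (filterlim_ext P).
  { intros K. apply sum_n_ext. intros k.
    exact (f_equal (fun t => t * b k) (eq_sym (pow_n_Cpow h k))). }
  apply (proj2 (filterlim_locally_ball_norm
                  (K := C_AbsRing) (U := C_NormedModule) _ f)).
  intros eps.
  apply is_lim_seq_spec in Hlim.
  destruct (Hlim eps) as [N HN]. exists N. intros K HK.
  specialize (HN K HK).
  change (Cmod (P K - f) < eps)%R.
  rewrite <- Cmod_opp.
  replace (- (P K - f)) with (f - P K) by ring.
  apply Rle_lt_trans with (1 := Hbound K).
  rewrite Rminus_0_r in HN.
  exact (Rle_lt_trans _ _ _ (Rle_abs _) HN).
Qed.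

Lemma analytic_at_power_series (a : nat -> C) (f : C -> C) (w : C) (M R : R) :
  (forall n, (Cmod (a n) * R ^ n <= M)%R) ->
  (Cmod w < R)%R ->
  (forall z, (Cmod z < R)%R ->
     is_series (K := C_AbsRing) (V := C_NormedModule)
       (fun n => a n * z ^ n) (f z)) ->
  analytic_at f w.
Proof.
  intros Ha Hw Hf. pose proof (Cmod_ge_0 w) as Hw0.
  (* half the distance to the boundary, so that [Cmod w + s < R] strictly *)
  set (s := ((R - Cmod w) / 2)%R).
  assert (Hs : (0 < s)%R) by (unfold s; lra).
  assert (HsR : (Cmod w + s < R)%R) by (unfold s; lra).
  exists s, (fun k => CSeries (fun n => a n * shift_coef w n k)).
  split; [exact Hs|]. intros z Hz.
  apply (is_pseries_shift a _ w (z - w) (f z) M R s); auto.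
  - replace (w + (z - w)) with z by ring. apply Hf.
    replace z with (w + (z - w)) by ring.
    eapply Rle_lt_trans; [apply Cmod_triangle|]. lra.
  - intros k. apply is_series_CSeries.
    apply (ex_series_geom_bound _ _ M R (Cmod w + s) (/ s ^ k)); auto.
    + lra.
    + left. apply Rinv_0_lt_compat, pow_lt, Hs.
    + intros n. apply Cmod_shift_coef, Hs.
Qed.

(** * The coefficients of the q-exponential *)

Lemma eventually_nonincr_bounded (u : nat -> R) :
  eventually (fun n => (u (S n) <= u n)%R) ->
  exists M, forall n, (u n <= M)%R.
Proof.
  intros [N HN].
  assert (Hinit : forall m, exists M, forall n, (n <= m)%nat -> (u n <= M)%R).
  { induction m as [|m [M HM]].
    - exists (u 0%nat). intros n Hn. replace n with 0%nat by lia. lra.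
    - exists (Rmax M (u (S m))). intros n Hn.
      destruct (Nat.eq_dec n (S m)) as [->|Hne]; [apply Rmax_r|].
      apply Rle_trans with (2 := Rmax_l _ _). apply HM. lia. }
  destruct (Hinit N) as [M HM]. exists M. intros n.
  destruct (Nat.le_gt_cases n N) as [Hn|Hn]; [apply HM, Hn|].
  apply Rle_trans with (u N); [|apply HM; lia].
  induction Hn as [|n Hn IH]; [apply HN; lia|].
  apply Rle_trans with (2 := IH). apply HN. lia.
Qed.

Lemma qnum_neq0 (q : C) (n : nat) : (Cmod q < 1)%R -> qnum q (S n) <> 0.
Proof.
  intros Hq.
  assert (Hne : forall m, 1 - q ^ S m <> 0).
  { intros m Hm.
    assert (Hpow : q ^ S m = 1).
    { replace (q ^ S m) with (1 - (1 - q ^ S m)) by ring. rewrite Hm. ring. }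
    assert (Hlt : (Cmod (q ^ S m) < 1)%R).
    { rewrite Cmod_pow. pose proof (Cmod_ge_0 q).
      apply pow_lt_1_compat; [lra|lia]. }
    rewrite Hpow, Cmod_1 in Hlt. lra. }
  unfold qnum, Cdiv. apply Cmult_neq_0; [apply Hne|].
  intros Hinv. apply C1_nz.
  rewrite <- (Cinv_r (1 - q)).
  - rewrite Hinv. ring.
  - pose proof (Hne 0%nat) as H0. rewrite Cpow_1_r in H0. exact H0.
Qed.

Lemma qfact_neq0 (q : C) (n : nat) : (Cmod q < 1)%R -> qfact q n <> 0.
Proof.
  intros Hq. induction n as [|n IH]; simpl.
  - apply C1_nz.
  - apply Cmult_neq_0; [exact IH | apply qnum_neq0, Hq].
Qed.

(** For [R * l < 1] the ratio is eventually less than [/ R], so each term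
    [Cmod (a n) * R ^ n] dominates the next one. *)
Lemma ratio_coef_bound (alpha : C -> nat -> C) (q : C) (l R : R) :
  (Cmod q < 1)%R ->
  eventually (fun n => alpha q n <> RtoC 0) ->
  is_lim_seq
    (fun n => Cmod (alpha q (S n) / (qnum q (S n) * alpha q n))) (Finite l) ->
  (0 < R)%R -> (R * l < 1)%R ->
  exists M, forall n, (Cmod (alpha q n / qfact q n) * R ^ n <= M)%R.
Proof.
  intros Hq Hne Hlim HR HRl.
  apply eventually_nonincr_bounded.
  assert (Hl : (l < / R)%R).
  { apply Rmult_lt_reg_l with R; [exact HR|]. rewrite Rinv_r; lra. }
  apply is_lim_seq_spec in Hlim.
  assert (Heps : (0 < / R - l)%R) by lra.
  generalize (filter_and _ _ Hne (Hlim (mkposreal _ Heps))).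
  apply filter_imp. intros n [Hn Hratio]. simpl in Hratio.
  pose proof (qnum_neq0 q n Hq) as Hqn.
  pose proof (qfact_neq0 q n Hq) as Hqf.
  set (t := alpha q (S n) / (qnum q (S n) * alpha q n)) in Hratio.
  replace (alpha q (S n) / qfact q (S n)) with (t * (alpha q n / qfact q n))
    by (unfold t; simpl qfact; field; auto).
  rewrite Cmod_mult.
  assert (Ht : (Cmod t * R <= 1)%R).
  { apply Rmult_le_reg_r with (/ R)%R; [apply Rinv_0_lt_compat, HR|].
    rewrite Rmult_assoc, Rinv_r, Rmult_1_r, Rmult_1_l by lra.
    pose proof (Rle_abs (Cmod t - l)). lra. }
  replace (Cmod t * Cmod (alpha q n / qfact q n) * R ^ S n)%R
    with ((Cmod t * R) * (Cmod (alpha q n / qfact q n) * R ^ n))%R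
    by (simpl; ring).
  rewrite <- Rmult_1_l. apply Rmult_le_compat_r; [|exact Ht].
  apply Rmult_le_pos; [apply Cmod_ge_0 | apply pow_le; lra].
Qed.

(** The inequality [R * l < 1] says that [R] is less than [inv_radius l] also
    when [l = 0], so later arguments need no case distinction. *)
Lemma open_disc_larger_radius (l : R) (z : C) :
  (0 <= l)%R -> open_disc (inv_radius l) z ->
  exists R, (Cmod z < R)%R /\ (R * l < 1)%R.
Proof.
  intros Hl. unfold open_disc, inv_radius.
  destruct (Req_EM_T l 0) as [->|Hne]; simpl; intros Hz.
  - exists (Cmod z + 1)%R. lra.
  - exists ((Cmod z + / l) / 2)%R. split; [lra|].
    apply Rmult_lt_compat_r with (r := l) in Hz; [|lra].
    rewrite Rinv_l in Hz by exact Hne.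
    replace ((Cmod z + / l) / 2 * l)%R with ((Cmod z * l + 1) / 2)%R
      by (field; exact Hne).
    lra.
Qed.

Theorem lemma2 (alpha : C -> nat -> C)
  (alpha_lim : forall n : nat,
     filterlim (fun x : R => alpha (RtoC x) n) (at_left 1%R)
               (locally (T := C_UniformSpace) (RtoC 1)))
  (q : C) (q_pos : (0 < Cmod q)%R) (q_lt1 : (Cmod q < 1)%R)
  (alpha_neq0 : eventually (fun n : nat => alpha q n <> RtoC 0))
  (l : R)
  (ratio_lim : is_lim_seq
     (fun n : nat => Cmod (alpha q (S n) / (qnum q (S n) * alpha q n)))
     (Finite l)) :
  (forall z : C, open_disc (inv_radius l) z ->
     ex_series (K := C_AbsRing) (V := C_NormedModule) (qexp_term alpha q z)) /\
  analytic_on (open_disc (inv_radius l)) (qexp alpha q).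
Proof.
  assert (Hl : (0 <= l)%R).
  { apply (is_lim_seq_le (fun _ => 0%R) _ (Finite 0) (Finite l))
      with (3 := ratio_lim); [|apply is_lim_seq_const].
    intros n. apply Cmod_ge_0. }
  set (a := fun n => alpha q n / qfact q n).
  assert (Hterm : forall z n, a n * z ^ n = qexp_term alpha q z n).
  { intros z n. unfold a, qexp_term, Cdiv. ring. }
  assert (Hex : forall z M R,
    (forall n, (Cmod (a n) * R ^ n <= M)%R) -> (Cmod z < R)%R ->
    ex_series (K := C_AbsRing) (V := C_NormedModule) (qexp_term alpha q z)).
  { intros z M R HM Hz.
    apply (ex_series_ext (fun n => a n * z ^ n)); [apply Hterm|].
    apply (ex_series_geom_bound _ _ M R (Cmod z) 1); auto.
    - split; [apply Cmod_ge_0 | exact Hz].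
    - lra.
    - intros n. rewrite Cmod_pow. lra. }
  assert (Hbd : forall z, open_disc (inv_radius l) z ->
    exists R M, (Cmod z < R)%R /\ forall n, (Cmod (a n) * R ^ n <= M)%R).
  { intros z Hz.
    destruct (open_disc_larger_radius l z Hl Hz) as [R [HzR HRl]].
    pose proof (Cmod_ge_0 z).
    destruct (ratio_coef_bound alpha q l R) as [M HM]; auto; try lra.
    exists R, M. auto. }
  split.
  - intros z Hz. destruct (Hbd z Hz) as [R [M [HzR HM]]].
    exact (Hex z M R HM HzR).
  - intros w Hw. destruct (Hbd w Hw) as [R [M [HwR HM]]].
    apply (analytic_at_power_series a _ w M R HM HwR).
    intros z Hz.
    apply (is_series_ext (qexp_term alpha q z)).
    + intros n. symmetry. apply Hterm.
    + apply is_series_CSeries, (Hex z M R HM Hz).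
Qed.
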